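(* Let $p$ be a prime. Let $H$ and $K$ be conjugacy $p$-separable groups, let $A\leqslant H$ and $B\leqslant K$ be central subgroups (i.e. $A$ lies in the center of $H$ and $B$ lies in the center of $K$), and let $\varphi:A\to B$ be an isomorphism. Suppose every subgroup of $A$ of finite $p$-power index in $A$ is $p$-separable in $H$, and every subgroup of $B$ of finite $p$-power index in $B$ is $p$-separable in $K$. Then $G=\bigl(H*K;\ A=B,\ \varphi\bigr)$ is a conjugacy $p$-separable group.
   Context: $\bigl(H*K;\ A=B,\ \varphi\bigr)$ denotes the free product of $H$ and $K$ with subgroups $A$ and $B$ amalgamated via the isomorphism $\varphi$ (relations $a=a\varphi$, $a\in A$). A group $G$ is conjugacy $p$-separable if whenever $a,b\in G$ are not conjugate in $G$, there is a homomorphism $\psi$ of $G$ onto a finite $p$-group $X$ such that $a\psi$ and $b\psi$ are not conjugate in $X$. A subset $M$ of a group $Y$ is $p$-separable in $Y$ if for every $y\in Y$ with $y\notin M$ there is a homomorphism $\psi$ of $Y$ onto a finite $p$-group $X$ with $y\psi\notin M\psi$. A subgroup has finite $p$-index if its index is a (finite) power of $p$ (including index $1$). *)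

(* Defs.v *)
From mathcomp Require Import all_boot all_fingroup all_solvable.
From mathcomp Require Import pgroup.
Set Implicit Arguments. Unset Strict Implicit. Unset Printing Implicit Defensive.

Record AbsGroup := MkAbsGroup {
  gcar :> Type;
  gmul : gcar -> gcar -> gcar;
  gone : gcar;
  ginv : gcar -> gcar;
  gmulA : forall x y z, gmul x (gmul y z) = gmul (gmul x y) z;
  gmul1l : forall x, gmul gone x = x;
  gmulVl : forall x, gmul (ginv x) x = gone
}.

Arguments gmul {_}.
Arguments gone {_}.
Arguments ginv {_}.

Definition is_hom (G X : AbsGroup) (f : G -> X) : Prop :=
  forall x y, f (gmul x y) = gmul (f x) (f y).

Definition is_subgroup (G : AbsGroup) (S : G -> Prop) : Prop :=
  S gone /\ (forall x y, S x -> S y -> S (gmul x y)) /\ (forall x, S x -> S (ginv x)).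

Definition is_central_subgroup (G : AbsGroup) (S : G -> Prop) : Prop :=
  is_subgroup S /\ (forall a g, S a -> gmul a g = gmul g a).

Definition conj_in (G : AbsGroup) (a b : G) : Prop :=
  exists g : G, b = gmul (ginv g) (gmul a g).

Definition hom_onto_fin (G : AbsGroup) (gT : finGroupType) (psi : G -> gT) : Prop :=
  (forall x y, psi (gmul x y) = (psi x * psi y)%g) /\ (forall t : gT, exists x, psi x = t).

Definition conj_p_separable (p : nat) (G : AbsGroup) : Prop :=
  forall a b : G, ~ conj_in a b ->
    exists (gT : finGroupType) (psi : G -> gT),
      hom_onto_fin psi /\ pgroup p [set: gT] /\
      ~ (exists z : gT, psi b = (psi a ^ z)%g).

Definition p_separable_in (p : nat) (Y : AbsGroup) (M : Y -> Prop) : Prop :=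
  forall y : Y, ~ M y ->
    exists (gT : finGroupType) (psi : Y -> gT),
      hom_onto_fin psi /\ pgroup p [set: gT] /\
      ~ (exists m, M m /\ psi m = psi y).

(* C <= A (subgroups of G) and the index |A : C| equals n: there are n elements
   r_0, ..., r_(n-1) of A such that every a in A lies in exactly one left coset r_i C. *)
Definition index_eq (G : AbsGroup) (A C : G -> Prop) (n : nat) : Prop :=
  exists r : 'I_n -> G, (forall i, A (r i)) /\
    forall a, A a -> exists i, C (gmul (ginv (r i)) a) /\
                     forall j, C (gmul (ginv (r j)) a) -> j = i.

Definition finite_p_index_subgroup (p : nat) (G : AbsGroup) (A C : G -> Prop) : Prop :=
  is_subgroup C /\ (forall c, C c -> A c) /\ exists k, index_eq A C (p ^ k).

Definition is_iso_on (H K : AbsGroup) (A : H -> Prop) (B : K -> Prop) (phi : H -> K) : Prop :=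
  (forall a, A a -> B (phi a)) /\
  (forall a a', A a -> A a' -> phi (gmul a a') = gmul (phi a) (phi a')) /\
  (forall a a', A a -> A a' -> phi a = phi a' -> a = a') /\
  (forall b, B b -> exists a, A a /\ phi a = b).

(* (G, iH, iK) is the free product of H and K with A and B amalgamated via phi,
   characterised by its universal property (pushout in the category of groups). *)
Definition is_amalgamated_free_product (H K : AbsGroup) (A : H -> Prop) (phi : H -> K)
  (G : AbsGroup) (iH : H -> G) (iK : K -> G) : Prop :=
  is_hom iH /\ is_hom iK /\ (forall a, A a -> iH a = iK (phi a)) /\
  forall (X : AbsGroup) (fH : H -> X) (fK : K -> X),
    is_hom fH -> is_hom fK -> (forall a, A a -> fH a = fK (phi a)) ->
    (exists f : G -> X, is_hom f /\ (forall h, f (iH h) = fH h) /\ (forall k, f (iK k) = fK k)) /\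
    (forall f1 f2 : G -> X,
       is_hom f1 -> (forall h, f1 (iH h) = fH h) -> (forall k, f1 (iK k) = fK k) ->
       is_hom f2 -> (forall h, f2 (iH h) = fH h) -> (forall k, f2 (iK k) = fK k) ->
       forall g, f1 g = f2 g).

(* Main.v *)
Require Import Defs.
From mathcomp Require Import all_boot all_order all_fingroup all_algebra all_solvable.
From mathcomp Require Import pgroup boolp zify.

(* Write A = B for the amalgamated central subgroup of G. Every element of G is conjugate to an
   element of H, to one of K, or to a product h1 k1 ... hn kn with all h_i outside A and all k_i
   outside B. The separability hypotheses give p-quotients of H and K that induce the same finite
   quotient of A and keep finitely many letters outside A; their central product D is a finite
   p-quotient of G, and it already separates two elements of H or K.

   For a product x with n >= 1 and y with at most n syllable pairs, make D act on the free module
   with basis D * I, where I indexes the 2n letters x_i of x, and let E be the square-zero operator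
   sending (z, i) to (z x_i, i + 1) for z in A and killing the other basis vectors. Since E commutes
   with A, conjugating the action of H by 1 + tE and keeping the action of K gives a representation
   of G. The coefficient of t^(2n) in the trace of an element is, up to sign, the number of cyclic
   rotations of x that agree with it letter by letter modulo A with total A-defect 1: nonzero for x,
   zero for y. Hence the traces differ for some integer t divisible by p, and they still differ
   modulo a large power p^N; there the image of G is a finite p-group, because modulo p it acts
   through D. *)

Set Implicit Arguments. Unset Strict Implicit. Unset Printing Implicit Defensive.
Import Order.TTheory GRing.Theory Num.Theory.

(** * Elementary group theory for the record [AbsGroup] *)

Section AbsGroupTheory.
Variable G : AbsGroup.
Implicit Types x y z a b g : G.

Lemma gmulKl x y : gmul (ginv x) (gmul x y) = y.
Proof. by rewrite gmulA gmulVl gmul1l. Qed.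

Lemma gmulVr x : gmul x (ginv x) = gone.
Proof.
by rewrite -[LHS]gmul1l -{1}(gmulVl (ginv x)) -gmulA (gmulKl x) gmulVl.
Qed.

Lemma gmul1r x : gmul x gone = x.
Proof. by rewrite -(gmulVl x) gmulA gmulVr gmul1l. Qed.

Lemma gmulKVl x y : gmul x (gmul (ginv x) y) = y.
Proof. by rewrite gmulA gmulVr gmul1l. Qed.

Lemma gmulIl x y z : gmul x y = gmul x z -> y = z.
Proof. by move=> e; rewrite -(gmulKl x y) e gmulKl. Qed.

Lemma ginvM x y : ginv (gmul x y) = gmul (ginv y) (ginv x).
Proof. by apply: (@gmulIl (gmul x y)); rewrite gmulVr -gmulA gmulKVl gmulVr. Qed.

Lemma ginv1 : ginv (@gone G) = gone.
Proof. by rewrite -[LHS]gmul1r gmulVl. Qed.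

Lemma ginvK x : ginv (ginv x) = x.
Proof. by apply: (@gmulIl (ginv x)); rewrite gmulVr gmulVl. Qed.

Lemma conj_in_refl a : conj_in a a.
Proof. by exists gone; rewrite gmul1r ginv1 gmul1l. Qed.

Lemma conj_in_trans b a c : conj_in a b -> conj_in b c -> conj_in a c.
Proof. by move=> [g ->] [h ->]; exists (gmul g h); rewrite ginvM !gmulA. Qed.

Lemma conj_in_sym a b : conj_in a b -> conj_in b a.
Proof.
by move=> [g ->]; exists (ginv g); rewrite ginvK -!gmulA gmulVr gmul1r gmulKVl.
Qed.

Lemma conj_in_mulC a b : conj_in (gmul a b) (gmul b a).
Proof. by exists a; rewrite -gmulA gmulKl. Qed.

End AbsGroupTheory.

Section HomTheory.
Variables (G X : AbsGroup) (f : G -> X).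
Hypothesis fM : is_hom f.

Lemma hom1 : f gone = gone.
Proof. by apply: (@gmulIl _ (f gone)); rewrite -fM !gmul1r. Qed.

Lemma homV x : f (ginv x) = ginv (f x).
Proof. by apply: (@gmulIl _ (f x)); rewrite -fM !gmulVr hom1. Qed.

Lemma hom_conj a b : conj_in a b -> conj_in (f a) (f b).
Proof. by move=> [g ->]; exists (f g); rewrite !fM homV. Qed.

End HomTheory.

(** * Homomorphisms to finite groups and finite p-quotients *)

Definition abs_of_fin (gT : finGroupType) : AbsGroup :=
  @MkAbsGroup gT (fun x y => x * y)%g 1%g (fun x => x^-1)%g
    (@mulgA gT) (@mul1g gT) (@mulVg gT).

Definition fin_hom (G : AbsGroup) (gT : finGroupType) (f : G -> gT) : Prop :=
  @is_hom G (abs_of_fin gT) f.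

Section FinHom.
Variables (G : AbsGroup) (gT : finGroupType) (f : G -> gT).
Hypothesis fM : fin_hom f.

Lemma fin_homM x y : f (gmul x y) = (f x * f y)%g. Proof. exact: fM. Qed.
Lemma fin_hom1 : f gone = 1%g. Proof. exact: hom1 fM. Qed.
Lemma fin_homV x : f (ginv x) = (f x)^-1%g. Proof. exact: (homV fM x). Qed.

Lemma fin_hom_image_group_set : group_set [set t | `[< exists x, f x = t >]].
Proof.
apply/group_setP; split=> [|s t].
  by rewrite inE; apply/asboolP; exists gone; exact: fin_hom1.
rewrite !inE => /asboolP[x <-] /asboolP[y <-]; apply/asboolP.
by exists (gmul x y); exact: fM.
Qed.

(** Maps given by the universal property need not be onto, as [hom_onto_fin] demands; the target is
    shrunk to the image, with inclusion [j]. *)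
Lemma fin_hom_corestrict : exists (gT' : finGroupType) (f' : G -> gT') (j : gT' -> gT),
  [/\ hom_onto_fin f', {morph j : x y / (x * y)%g}, injective j & forall x, j (f' x) = f x].
Proof.
pose I := Group fin_hom_image_group_set.
have fI x : f x \in I by rewrite inE; apply/asboolP; exists x.
have jf x : sgval (subg I (f x)) = f x by rewrite subgK.
exists (subg_of I), (fun x => subg I (f x)), (@sgval _ I); split=> //.
- split=> [x y|t]; first by apply: val_inj; rewrite /= !subgK ?groupM ?fI ?fin_homM.
  have := subgP t; rewrite inE => /asboolP[x e]; exists x.
  by rewrite e sgvalK.
- exact: val_inj.
Qed.

End FinHom.

(** By Cauchy's theorem each prime divisor of the group order is the order of an element. *)
Lemma pgroup_of_p_elts (p : nat) (gT : finGroupType) : prime p ->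
  (forall x : gT, exists k, (x ^+ (p ^ k) = 1)%g) -> pgroup p [set: gT].
Proof.
move=> pp h; apply/pgroupP => q qp /(Cauchy qp)[x _ ox].
have [k xk] := h x; rewrite !inE.
have : q %| p ^ k by rewrite -ox order_dvdn xk.
by rewrite (Euclid_dvdX _ _ qp) => /andP[]; rewrite dvdn_prime2.
Qed.

Lemma p_elt_of_pgroup (p : nat) (gT : finGroupType) : pgroup p [set: gT] ->
  forall x : gT, exists k, (x ^+ (p ^ k) = 1)%g.
Proof.
move=> pT x; have [k ok] := p_natP (mem_p_elt pT (in_setT x)).
by exists k; apply/eqP; rewrite -order_dvdn ok.
Qed.

Definition conj_p_separated (p : nat) (G : AbsGroup) (a b : G) : Prop :=
  exists (gT : finGroupType) (psi : G -> gT),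
      hom_onto_fin psi /\ pgroup p [set: gT] /\
      ~ (exists z : gT, psi b = (psi a ^ z)%g).

Section Separated.
Variables (p : nat) (G : AbsGroup).
Hypothesis pp : prime p.

(** Only the image has to be a p-group: the target will also be a full unit group of matrices, which
    need not be one. *)
Lemma conj_p_separated_of_hom (gT : finGroupType) (psi : G -> gT) (a b : G) :
  fin_hom psi -> (forall x, exists k, (psi x ^+ (p ^ k) = 1)%g) ->
  ~ (exists z : gT, psi b = (psi a ^ z)%g) -> conj_p_separated p a b.
Proof.
move=> psiM pe nc; have [gT' [f' [j [[f'M f's] jM ji jf]]]] := fin_hom_corestrict psiM.
have j1 : j 1%g = 1%g by apply: (mulgI (j 1%g)); rewrite -jM !mulg1.
have jX x k : j (x ^+ k)%g = (j x ^+ k)%g.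
  by elim: k => // k IH; rewrite !expgS jM IH.
have jV x : j x^-1%g = (j x)^-1%g by apply: (mulgI (j x)); rewrite -jM !mulgV.
exists gT', f'; split; first by split.
split; first apply: pgroup_of_p_elts => // t.
  have [x <-] := f's t; have [k e] := pe x; exists k.
  by apply: ji; rewrite jX jf e j1.
by move=> [z e]; apply: nc; exists (j z); rewrite -!jf e !conjgE !jM jV.
Qed.

Lemma conj_p_separated_conj (a b a' b' : G) : conj_in a a' -> conj_in b b' ->
  conj_p_separated p a b -> conj_p_separated p a' b'.
Proof.
move=> [g ->] [h ->] [gT [psi [[psiM psis] [pT nc]]]].
have psiV x : psi (ginv x) = (psi x)^-1%g by exact: (@fin_homV _ _ _ psiM x).
exists gT, psi; do 2!split=> //; move=> [z e]; apply: nc.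
exists (psi g * z * (psi h)^-1)%g; move: e; rewrite !psiM !psiV => e.
have -> : psi b = (((psi h)^-1 * (psi b * psi h)) ^ (psi h)^-1)%g.
  by rewrite conjgE !mulgA !invgK mulgV mul1g -mulgA mulgV mulg1.
by rewrite e !conjgM conjgE !conjgE !invgK !mulgA.
Qed.

Lemma conj_p_separated_sym (a b : G) : conj_p_separated p a b -> conj_p_separated p b a.
Proof.
move=> [gT [psi [hs [pT nc]]]]; exists gT, psi; do 2!split=> //.
by move=> [z e]; apply: nc; exists (z^-1)%g; rewrite e conjgK.
Qed.

End Separated.

(** * Symmetry between the two factors *)

Lemma inverse_iso (H K : AbsGroup) (A : H -> Prop) (B : K -> Prop) (phi : H -> K) :
  is_subgroup A -> is_iso_on A B phi ->
  exists psi : K -> H, [/\ is_iso_on B A psi, forall a, A a -> psi (phi a) = a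
    & forall b, B b -> phi (psi b) = b].
Proof.
move=> [_ [AM _]] [phiB [phiM [phiI phiS]]].
(* Guarding by [B b] makes the choice total; the values outside [B] are arbitrary. *)
have ex b : exists a, B b -> A a /\ phi a = b.
  by have [/phiS[a e]|nb] := pselect (B b); [exists a | exists gone].
pose psi b := projT1 (cid (ex b)).
have psiP b : B b -> A (psi b) /\ phi (psi b) = b := projT2 (cid (ex b)).
have psiA b : B b -> A (psi b) by move=> /psiP[].
have psiK b : B b -> phi (psi b) = b by move=> /psiP[].
have phiK a : A a -> psi (phi a) = a.
  by move=> Aa; apply: phiI => //; [apply/psiA/phiB | apply/psiK/phiB].
have BM b b' : B b -> B b' -> B (gmul b b').
  by move=> Bb Bb'; rewrite -(psiK b) // -(psiK b') // -phiM; auto.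
exists psi; split=> //; split=> //; split.
  by move=> b b' Bb Bb'; apply: phiI; auto; rewrite phiM ?psiK; auto.
split; first by move=> b b' Bb Bb' e; rewrite -(psiK b) // e psiK.
by move=> a Aa; exists (phi a); split; auto.
Qed.

(** Through this symmetry, what is proved for two elements of [H] also applies to two elements of
    [K]. *)
Lemma amalgam_sym (H K : AbsGroup) (A : H -> Prop) (B : K -> Prop) (phi : H -> K)
    (psi : K -> H) (G : AbsGroup) (iH : H -> G) (iK : K -> G) :
  is_iso_on A B phi -> is_iso_on B A psi ->
  (forall a, A a -> psi (phi a) = a) -> (forall b, B b -> phi (psi b) = b) ->
  is_amalgamated_free_product A phi iH iK -> is_amalgamated_free_product B psi iK iH.
Proof.
move=> [phiB _] [psiA _] phiK psiK [iHM [iKM [iHK univ]]].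
split=> //; split=> //; split.
  by move=> b Bb; rewrite -{1}(psiK b) // iHK; auto.
move=> X fK fH fKM fHM fKH.
have fHK a : A a -> fH a = fK (phi a) by move=> Aa; rewrite fKH ?phiK; auto.
have [[f [fM [fh fk]]] uni] := univ X fH fK fHM fKM fHK.
by split; [exists f | move=> f1 f2; auto].
Qed.

(** * Finite p-quotients with a prescribed kernel on the central subgroup *)

Section Kernels.
Variables (p : nat) (H : AbsGroup) (A : H -> Prop).
Hypothesis Ac : is_central_subgroup A.

Let A1 : A gone. Proof. by case: Ac => -[]. Qed.
Let AM x y : A x -> A y -> A (gmul x y). Proof. by case: Ac => -[_ [h _]] _; exact: h. Qed.
Let AV x : A x -> A (ginv x). Proof. by case: Ac => -[_ [_ h]] _; exact: h. Qed.
Let AC a g : A a -> gmul a g = gmul g a. Proof. by case: Ac => _ h; exact: h. Qed.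

(** The image of [A] is a subgroup of a p-group, and preimages of its elements represent the cosets
    of the kernel. Multiplicativity is asked on [A] only, because the lemma also serves for [B] with
    a map through [psi], which need not be multiplicative outside [B]. *)
Lemma ker_finite_p_index (gT : finGroupType) (t : H -> gT) : pgroup p [set: gT] ->
  (forall a b, A a -> A b -> t (gmul a b) = (t a * t b)%g) ->
  finite_p_index_subgroup p A (fun a => A a /\ t a = 1%g).
Proof.
move=> pT tM.
have t1 : t gone = 1%g by apply: (mulgI (t gone)); rewrite -tM // gmul1l mulg1.
have tV a : A a -> t (ginv a) = (t a)^-1%g.
  by move=> Aa; apply: (mulgI (t a)); rewrite -tM ?gmulVr ?t1 ?mulgV; auto.
split; first split; first by split.
  split=> [x y [Ax tx] [Ay ty]|x [Ax tx]]; split; auto.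
    by rewrite tM // tx ty mulg1.
  by rewrite tV // tx invg1.
split; first by move=> c [].
pose I := [set s | `[< exists a, A a /\ t a = s >]].
have gI : group_set I.
  apply/group_setP; split=> [|s u]; first by rewrite inE; apply/asboolP; exists gone.
  rewrite !inE => /asboolP[x [Ax <-]] /asboolP[y [Ay <-]]; apply/asboolP.
  by exists (gmul x y); rewrite tM //; split; auto.
have : pgroup p (Group gI) by apply: pgroupS pT; exact: subsetT.
move/p_natP => [k ek]; exists k; rewrite -ek /=.
have rP (i : 'I_#|I|) : exists a, A a /\ t a = enum_val i.
  by have := enum_valP i; rewrite inE => /asboolP.
exists (fun i => projT1 (cid (rP i))); split.
  by move=> i; case: (projT2 (cid (rP i))).
move=> a Aa.
have aI : t a \in I by rewrite inE; apply/asboolP; exists a.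
have key i : A (projT1 (cid (rP i))) /\ t (projT1 (cid (rP i))) = enum_val i :=
  projT2 (cid (rP i)).
have ta j : t (gmul (ginv (projT1 (cid (rP j)))) a) = ((enum_val j)^-1 * t a)%g.
  by have [Aj ej] := key j; rewrite tM ?tV ?ej; auto.
exists (enum_rank_in aI (t a)); split.
  split; first by case: (key (enum_rank_in aI (t a))); auto.
  by rewrite ta enum_rankK_in // mulVg.
move=> j [_]; rewrite ta => /(canRL (mulKVg _)); rewrite mulg1 => e.
by apply: enum_val_inj; rewrite enum_rankK_in.
Qed.

Definition p_kernel (N : H -> Prop) : Prop :=
  exists (gT : finGroupType) (f : H -> gT),
    [/\ fin_hom f, pgroup p [set: gT] & forall h, N h <-> f h = 1%g].

Lemma p_kernelT : p_kernel (fun=> True).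
Proof.
exists 'I_1, (fun=> ord0); split=> //.
  by move=> x y; apply: val_inj.
by rewrite /pgroup cardsT card_ord.
Qed.

Lemma p_kernelI N N' : p_kernel N -> p_kernel N' -> p_kernel (fun h => N h /\ N' h).
Proof.
move=> [gT [f [fM pT fN]]] [gT' [f' [fM' pT' fN']]].
exists (gT * gT')%type, (fun h => (f h, f' h)); split.
- by move=> x y; rewrite /= (fin_homM fM) (fin_homM fM').
- by rewrite /pgroup cardsT card_prod pnatM -!cardsT; apply/andP.
- move=> h; rewrite fN fN'; split=> [[-> ->] //|e]; split.
    exact: (congr1 fst e).
  exact: (congr1 snd e).
Qed.

(** Kernels of p-quotients are closed under finite intersections, so finitely many requirements that
    pass to smaller kernels can be met at once. *)
Lemma p_kernel_all (I : eqType) (s : seq I) (P : I -> (H -> Prop) -> Prop) :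
  (forall i (N N' : H -> Prop), (forall h, N' h -> N h) -> P i N -> P i N') ->
  (forall i, i \in s -> exists N, p_kernel N /\ P i N) ->
  exists N, p_kernel N /\ forall i, i \in s -> P i N.
Proof.
move=> mono; elim: s => [|i s IH] ex; first by exists (fun=> True); split=> //; exact: p_kernelT.
have [j js|N [pN PN]] := IH; first by apply: ex; rewrite inE js orbT.
have [N' [pN' PN']] := ex i (mem_head i s).
exists (fun h => N h /\ N' h); split; first exact: p_kernelI.
move=> j; rewrite inE => /predU1P[->|js]; first by apply: mono PN' => h [].
by apply: mono (PN j js) => h [].
Qed.

End Kernels.

(** [coset Q] is multiplicative only on the normalizer of [Q], which is the whole group when [Q] is
    central. *)
Lemma central_coset (gT : finGroupType) (Q : {group gT}) :
  (forall q t, q \in Q -> (q * t = t * q)%g) ->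
  [/\ {morph coset Q : x y / (x * y)%g}, forall u, exists x, coset Q x = u
    & forall x y, coset Q x = coset Q y <-> (x^-1 * y)%g \in Q].
Proof.
move=> QC.
have nQ x : x \in 'N(Q)%g.
  by apply/(subsetP (cent_sub Q))/centP => q qQ; rewrite /commute (QC q).
have cM : {morph coset Q : x y / (x * y)%g} by move=> x y; exact: morphM.
split=> // [u|x y]; first by have [x _ ->] := cosetP u; exists x.
split=> [e|/coset_id e]; last by rewrite -[in RHS](mulKVg x y) cM e mulg1.
by apply: coset_idr; rewrite // cM -e -cM mulVg coset_id.
Qed.

Lemma pgroup_surj (p : nat) (gT hT : finGroupType) (f : gT -> hT) : prime p ->
  {morph f : x y / (x * y)%g} -> (forall u, exists x, f x = u) ->
  pgroup p [set: gT] -> pgroup p [set: hT].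
Proof.
move=> pp fM fs pT; apply: pgroup_of_p_elts => // u; have [x <-] := fs u.
have f1 : f 1%g = 1%g by apply: (mulgI (f 1%g)); rewrite -fM !mulg1.
have [k e] := p_elt_of_pgroup pT x; exists k; rewrite -f1 -e.
by elim: (p ^ k) => // m IH; rewrite !expgS fM IH.
Qed.

Section PQuotients.
Variables (p : nat) (H : AbsGroup).
Hypothesis pp : prime p.

Lemma p_separable_family (I : finType) (M : I -> H -> Prop) (y : I -> H) :
  (forall i, ~ M i (y i) -> p_separable_in p (M i)) ->
  exists N, p_kernel p N /\
    forall i, ~ M i (y i) -> ~ exists m, M i m /\ N (gmul (ginv m) (y i)).
Proof.
move=> sep.
have [i N N' NN' PN nM [m [Mm Nm]]|i _|N [pN PN]] := @p_kernel_all p H I (enum I) (fun i N =>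
    ~ M i (y i) -> ~ exists m, M i m /\ N (gmul (ginv m) (y i))).
- by apply: PN => //; exists m; split; auto.
- have [Mi|nM] := pselect (M i (y i)).
    by exists (fun=> True); split=> //; exact: p_kernelT.
  have [gT [psi [[psiM _] [pT nsep]]]] := sep i nM _ nM.
  exists (fun h => psi h = 1%g); split; first by exists gT, psi; split.
  move=> _ [m [Mm e]]; apply: nsep; exists m; split=> //.
  rewrite -[y i](gmulKVl m).
  by rewrite -[LHS]mulg1 -e -psiM.
- by exists N; split=> // i; apply: PN; rewrite mem_enum.
Qed.

Variable A : H -> Prop.
Hypothesis Ac : is_central_subgroup A.
Hypothesis Asep : forall C, finite_p_index_subgroup p A C -> p_separable_in p C.

Lemma finite_p_index_self : finite_p_index_subgroup p A A.
Proof.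
case: Ac => -[A1 [AM AV]] _; split; first by split.
split=> //; exists 0; exists (fun=> gone); split=> // a Aa.
exists ord0; rewrite ginv1 gmul1l; split=> // j _.
by apply: val_inj; case: j => [[]].
Qed.

(** A first p-quotient keeps the coset representatives of [C] in [A] that lie outside [C] apart from
    [C], and the [s i] outside [A] apart from [A]. Dividing it by the central image of [C] then
    makes the kernel on [A] exactly [C]. *)
Lemma p_quotient_with_kernel (C : H -> Prop) (I : finType) (s : I -> H) :
  finite_p_index_subgroup p A C ->
  exists (gT : finGroupType) (f : H -> gT),
    [/\ hom_onto_fin f, pgroup p [set: gT], forall a, A a -> (f a = 1%g <-> C a)
      & forall i, ~ A (s i) -> ~ exists a, A a /\ f a = f (s i)].
Proof.
move=> Cfin; have [[C1 [CM CV]] [CA [k [r [rA rP]]]]] := Cfin.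
case: Ac => -[A1 [AM AV]] AC.
pose M (j : 'I_(p ^ k) + I) := if j is inl _ then C else A.
pose y (j : 'I_(p ^ k) + I) := match j with inl i => r i | inr i => s i end.
have [|N [[gT0 [f0 [f0M pT0 f0N]]] sepN]] := @p_separable_family ('I_(p ^ k) + I)%type M y.
  by move=> [j|j] _ /=; apply: Asep => //; exact: finite_p_index_self.
have [gT [f [j [[fM fs] jM ji jf]]]] := fin_hom_corestrict f0M.
have fhom : fin_hom f by [].
have pT : pgroup p [set: gT].
  apply: pgroup_of_p_elts => // t; have [k' e] := p_elt_of_pgroup pT0 (j t).
  have j1 : j 1%g = 1%g by apply: (mulgI (j 1%g)); rewrite -jM !mulg1.
  exists k'; apply: ji; rewrite j1 -e.
  by elim: (p ^ k') => // m IH; rewrite !expgS jM IH.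
have fN h : N h <-> f h = 1%g.
  rewrite f0N -jf -[X in _ = X <-> _](fin_hom1 f0M) -jf (fin_hom1 fhom).
  by split=> [/ji|->].
(* The image of [C], central because [C] is contained in [A]. *)
pose Q := [set t | `[< exists c, C c /\ f c = t >]].
have gQ : group_set Q.
  apply/group_setP; split=> [|u v].
    by rewrite inE; apply/asboolP; exists gone; rewrite (fin_hom1 fhom).
  rewrite !inE => /asboolP[c [Cc <-]] /asboolP[d [Cd <-]]; apply/asboolP.
  by exists (gmul c d); rewrite fM; split; auto.
have [|qM qs qK] := @central_coset gT (Group gQ).
  move=> q t; rewrite inE => /asboolP[c [Cc <-]]; have [h <-] := fs t.
  by rewrite -!fM AC //; exact: CA.
exists (coset_of (Group gQ)), (fun h => coset (Group gQ) (f h)).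
have eqP g h : coset (Group gQ) (f g) = coset (Group gQ) (f h) <->
    exists c, C c /\ N (gmul (ginv c) (gmul (ginv g) h)).
  rewrite qK inE; split=> [/asboolP|] [c [Cc e]].
    exists c; split=> //; apply/fN.
    by rewrite !fM (fin_homV fhom c) e (fin_homV fhom g) mulVg.
  apply/asboolP; exists c; split=> //; apply: (mulgI (f c)^-1%g); rewrite mulVg.
  by move/fN: e; rewrite !fM (fin_homV fhom c) (fin_homV fhom g).
split.
- split=> [x z|u]; first by rewrite /= fM qM.
  by have [x <-] := qs u; have [h <-] := fs x; exists h.
- exact: (pgroup_surj pp qM qs pT).
- move=> a Aa.
  have -> : (1 = coset (Group gQ) (f gone) :> coset_of (Group gQ))%g.
    by rewrite (fin_hom1 fhom) coset_id ?group1.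
  split=> [/esym/eqP[c [Cc]]|Ca]; last first.
    apply/esym/eqP; exists a; split=> //; apply/fN.
    by rewrite ginv1 gmul1l gmulVl (fin_hom1 fhom).
  (* Here [a] lies in the product of [C] and [N], hence so does its representative [r i]; by the
     choice of [N] this forces [r i], and with it [a], into [C]. *)
  rewrite ginv1 gmul1l => Nca; have [i [Cia _]] := rP a Aa.
  have [Ci|nCi] := pselect (C (r i)); first by rewrite -(gmulKVl (r i) a); auto.
  case: (sepN (inl i) nCi) => /=.
  exists (gmul c (ginv (gmul (ginv (r i)) a))); split; first by auto.
  by rewrite ginvM ginvK -gmulA AC ?gmulKVl -?gmulA ?gmulKVl //; auto.
- move=> i nA [a [Aa /eqP[c [Cc Nc]]]]; apply: (sepN (inr i) nA).
  by exists (gmul a c); rewrite ginvM -gmulA; split=> //=; apply: AM => //; exact: CA.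
Qed.
End PQuotients.

(** * The central product of two finite p-quotients *)

Section CentralProduct.
Variables (p : nat) (H K : AbsGroup) (A : H -> Prop) (B : K -> Prop) (phi : H -> K).
Variables (gT hT : finGroupType) (f : H -> gT) (g : K -> hT).
Hypotheses (pp : prime p) (Ac : is_central_subgroup A) (Bc : is_central_subgroup B).
Hypothesis phi_iso : is_iso_on A B phi.
Hypotheses (fonto : hom_onto_fin f) (gonto : hom_onto_fin g).
Hypotheses (pgT : pgroup p [set: gT]) (phT : pgroup p [set: hT]).
Hypothesis ker_fg : forall a, A a -> (f a = 1%g <-> g (phi a) = 1%g).

(** [D] is [gT * hT] modulo the central subgroup of all pairs [(f a, (g (phi a))^-1)]. Because [f]
    and [g \o phi] have the same kernel on [A], a pair of this subgroup with trivial second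
    coordinate is trivial, so [gT] embeds in [D] and conjugacy of its elements is not enlarged. An
    element of [gT] conjugate in [D] to one of [hT] must come from the amalgamated part. *)
Lemma central_product_p_quotient :
  exists (D : finGroupType) (F : H -> D) (F' : K -> D),
  [/\ fin_hom F, fin_hom F', pgroup p [set: D] & forall a, A a -> F a = F' (phi a)] /\
  [/\ forall a d, A a -> (F a * d = d * F a)%g,
      forall h h', (exists z, F h' = F h ^ z)%g -> exists x, (f h' = f h ^ x)%g,
      forall h k, (exists z, F' k = F h ^ z)%g ->
        exists a a', [/\ A a, A a', f h = f a & g k = g (phi a')]
    & forall h h', f h = f h' -> F h = F h'].
Proof.
case: (Ac) => -[A1 [AM AV]] AC; case: (Bc) => -[B1 [BM BV]] BC.
case: phi_iso => phiB [phiM [phiI phiS]].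
have [fM fs] := fonto; have [gM gs] := gonto.
have fh : fin_hom f by []. have gh : fin_hom g by [].
have phi1 : phi gone = gone.
  by apply: (@gmulIl _ (phi gone)); rewrite -phiM // !gmul1r.
have phiV a : A a -> phi (ginv a) = ginv (phi a).
  by move=> Aa; apply: (@gmulIl _ (phi a)); rewrite -phiM ?gmulVr ?phi1; auto.
pose Q : {set gT * hT} := [set t | `[< exists a, A a /\ (f a, (g (phi a))^-1%g) = t >]].
have gQ : group_set Q.
  apply/group_setP; split=> [|u v].
    rewrite inE; apply/asboolP; exists gone; split=> //.
    by rewrite phi1 (fin_hom1 fh) (fin_hom1 gh) invg1.
  rewrite !inE => /asboolP[c [Ac' <-]] /asboolP[d [Ad <-]]; apply/asboolP.
  exists (gmul c d); split; first by auto.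
  by rewrite phiM // BC ?fM ?gM ?invMg //; auto.
have fC a x : A a -> (f a * x = x * f a)%g.
  by move=> Aa; have [h <-] := fs x; rewrite -!fM AC.
have gC a y : A a -> (g (phi a) * y = y * g (phi a))%g.
  by move=> Aa; have [k <-] := gs y; rewrite -!gM BC //; auto.
have [|qM qs qK] := @central_coset _ (Group gQ).
  move=> q [x y]; rewrite inE => /asboolP[a [Aa <-]].
  congr pair => /=; first exact: fC.
  by rewrite -(fin_homV gh) -phiV //; apply: gC; auto.
pose q := coset (Group gQ); rewrite -/q in qM.
have qV t : q t^-1%g = (q t)^-1%g.
  by apply: (mulgI (q t)); rewrite -qM !mulgV /q coset_id ?group1.
have qJ t z : q (t ^ z)%g = (q t ^ q z)%g by rewrite !conjgE !qM qV.
have qE x y x' y' : q (x, y) = q (x', y') ->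
    exists a, [/\ A a, x' = (x * f a)%g & y' = (y * (g (phi a))^-1)%g].
  rewrite /q qK inE => /asboolP[a [Aa [e1 e2]]]; exists a; split=> //.
    by rewrite e1 mulKVg.
  by rewrite e2 mulKVg.
exists (coset_of (Group gQ)), (fun h => q (f h, 1%g)), (fun k => q (1%g, g k)); split.
  split.
  - by move=> h h'; rewrite /= -qM fM; congr (q (_, _)); rewrite /= mulg1.
  - by move=> k k'; rewrite /= -qM gM; congr (q (_, _)); rewrite /= mulg1.
  - apply: (pgroup_surj pp qM qs).
    by rewrite /pgroup cardsT card_prod pnatM -!cardsT; apply/andP.
  - move=> a Aa; apply/esym; rewrite /q qK inE; apply/asboolP; exists a; split=> //.
    by congr pair; rewrite /= ?invg1 ?mul1g ?mulg1.
split.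
- move=> a d Aa; have [[x y] <-] := qs d; rewrite -/q -!qM; congr q.
  by congr pair; rewrite /= ?mulg1 ?mul1g // fC.
- move=> h h' [z]; have [[x y] <-] := qs z; rewrite -/q -qJ conjgE.
  move/esym/qE => [a [Aa /= -> e2]]; exists x.
  have ga : g (phi a) = 1%g.
    by apply: invg_inj; rewrite invg1; move: e2; rewrite mul1g mulVg mul1g.
  by rewrite (ker_fg Aa).2 // mulg1 conjgE.
- move=> h k [z]; have [[x y] <-] := qs z; rewrite -/q -qJ conjgE.
  move/esym/qE => [a [Aa /= e1 e2]].
  exists (ginv a), (ginv a); split; auto; last first.
    by rewrite e2 mul1g mulVg mul1g phiV // (fin_homV gh).
  have {e1} : (f h ^ x = f (ginv a))%g.
    by apply: (mulIg (f a)); rewrite conjgE -e1 -fM gmulVl (fin_hom1 fh).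
  move/(congr1 (fun t => t ^ x^-1)%g); rewrite conjgK => ->.
  by rewrite conjgE fC ?mulgA ?invgK ?mulgV ?mul1g ?mulKg -?mulgA ?mulVg ?mulg1; auto.
- by move=> h h' ->.
Qed.

End CentralProduct.

(** * Words in an amalgamated product *)

Section SubAbsGroup.
Variables (G : AbsGroup) (S : G -> Prop).
Hypothesis Sg : is_subgroup S.

Let SM (x y : {x | S x}) : S (gmul (sval x) (sval y)).
Proof. by case: Sg => _ [h _]; apply: h; exact: svalP. Qed.
Let SV (x : {x | S x}) : S (ginv (sval x)).
Proof. by case: Sg => _ [_ h]; apply: h; exact: svalP. Qed.

Lemma sval_inj (x y : {x | S x}) : sval x = sval y -> x = y.
Proof. by case: x y => [x Sx] [y Sy] /= e; exact: eq_exist. Qed.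

Definition sub_abs : AbsGroup.
Proof.
refine (@MkAbsGroup {x | S x} (fun x y => exist _ _ (SM x y)) (exist _ _ (proj1 Sg))
  (fun x => exist _ _ (SV x)) _ _ _).
- by move=> x y z; apply: sval_inj; exact: gmulA.
- by move=> x; apply: sval_inj; exact: gmul1l.
- by move=> x; apply: sval_inj; exact: gmulVl.
Defined.

End SubAbsGroup.

Section Words.
Variables H K : AbsGroup.
Implicit Types w : seq (H * K).

Definition eval_word (X : AbsGroup) (fH : H -> X) (fK : K -> X) w : X :=
  foldr (fun hk x => gmul (gmul (fH hk.1) (fK hk.2)) x) gone w.

Lemma eval_word_cat (X : AbsGroup) (fH : H -> X) (fK : K -> X) w w' :
  eval_word fH fK (w ++ w') = gmul (eval_word fH fK w) (eval_word fH fK w').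
Proof. by elim: w => [|hk w IH] /=; rewrite ?gmul1l // IH gmulA. Qed.

Lemma eval_word_rot (X : AbsGroup) (fH : H -> X) (fK : K -> X) r w :
  conj_in (eval_word fH fK w) (eval_word fH fK (seq.rot r w)).
Proof.
by rewrite -[X in eval_word _ _ X](cat_take_drop r w) !eval_word_cat; exact: conj_in_mulC.
Qed.

Variables (A : H -> Prop) (B : K -> Prop) (phi : H -> K) (psi : K -> H).
Hypotheses (Ac : is_central_subgroup A) (Bc : is_central_subgroup B).
Hypotheses (phi_iso : is_iso_on A B phi) (psi_iso : is_iso_on B A psi).
Hypothesis psiK : forall b, B b -> phi (psi b) = b.

(** As the letters come in pairs, they alternate also across the end of the word, so this is cyclic
    reducedness. *)
Definition reduced w : Prop :=
  forall i, i < size w -> ~ A (nth (gone, gone) w i).1 /\ ~ B (nth (gone, gone) w i).2.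

Fixpoint matched w w' : Prop :=
  match w, w' with
  | [::], [::] => True
  | (h, k) :: u, (h', k') :: u' =>
      [/\ A (gmul (ginv h) h'), B (gmul (ginv k) k') & matched u u']
  | _, _ => False
  end.

(* The element of A by which two words with letters equal modulo A differ, see [eval_matched]. *)
Fixpoint defect w w' : H :=
  match w, w' with
  | (h, k) :: u, (h', k') :: u' =>
      gmul (gmul (gmul (ginv h) h') (psi (gmul (ginv k) k'))) (defect u u')
  | _, _ => gone
  end.

Section Compatible.
Variables (X : AbsGroup) (fH : H -> X) (fK : K -> X).
Hypotheses (fHM : is_hom fH) (fKM : is_hom fK).
Hypothesis fHK : forall a, A a -> fH a = fK (phi a).

Lemma amalgamated_commutes_letters a hk : A a ->
  gmul (fH a) (gmul (fH hk.1) (fK hk.2)) = gmul (gmul (fH hk.1) (fK hk.2)) (fH a).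
Proof.
move=> Aa; rewrite gmulA -fHM (proj2 Ac) // fHM -!gmulA; congr gmul.
by rewrite fHK // -!fKM (proj2 Bc) //; case: phi_iso; auto.
Qed.

Lemma amalgamated_commutes_word a w : A a ->
  gmul (fH a) (eval_word fH fK w) = gmul (eval_word fH fK w) (fH a).
Proof.
move=> Aa; elim: w => [|hk w IH] /=; first by rewrite gmul1l gmul1r.
by rewrite gmulA amalgamated_commutes_letters // -gmulA IH gmulA.
Qed.

(** Images of [A] commute with all letters, so the differences of the letters can be collected at
    the end. The target [X] is left free, to compare the words both in a finite quotient and in
    [G]. *)
Lemma eval_matched w w' : matched w w' ->
  A (defect w w') /\ eval_word fH fK w' = gmul (eval_word fH fK w) (fH (defect w w')).
Proof.
have [[A1 [AM AV]] _] := Ac.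
elim: w w' => [|[h k] u IH] [|[h' k'] u'] //=.
  by rewrite gmul1l hom1.
move=> [Ah Bk /IH[Ad ->]].
have Ak : A (psi (gmul (ginv k) k')) by case: psi_iso; auto.
split; first by auto.
have -> : fK k' = gmul (fK k) (fH (psi (gmul (ginv k) k'))).
  by rewrite fHK // psiK // -fKM gmulKVl.
have -> : fH h' = gmul (fH h) (fH (gmul (ginv h) h')) by rewrite -fHM gmulKVl.
have c1 := @amalgamated_commutes_letters _ (gone, k) Ah.
rewrite /= hom1 // gmul1l in c1.
move: Ah Ak c1; move: (gmul (ginv h) h') (psi _) => a1 a2 Aa1 Aa2 c1.
rewrite !fHM -!gmulA; congr gmul; rewrite gmulA c1 -gmulA; congr gmul.
by rewrite 2!gmulA -fHM amalgamated_commutes_word ?fHM -?gmulA //; auto.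
Qed.

End Compatible.

Variables (G : AbsGroup) (iH : H -> G) (iK : K -> G).
Hypothesis am : is_amalgamated_free_product A phi iH iK.
Notation eval := (eval_word iH iK).

(** The values of words form a subgroup that receives [H] and [K]; the induced map from [G] to it,
    followed by the inclusion, is the identity by uniqueness. *)
Lemma amalgam_generated g : exists w, g = eval w.
Proof.
case: am => iHM [iKM [iHK univ]].
have Sg : is_subgroup (fun g => exists w, g = eval w).
  split; first by exists [::].
  split; first by move=> _ _ [w ->] [w' ->]; exists (w ++ w'); rewrite eval_word_cat.
  move=> _ [w ->]; elim: w => [|[h k] w [w' IH]] /=; first by exists [::]; rewrite ginv1.
  exists (w' ++ [:: (gone, ginv k); (ginv h, gone)]).
  rewrite eval_word_cat /= -IH !ginvM (hom1 iHM) (hom1 iKM) gmul1l !gmul1r.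
  by rewrite (homV iHM) (homV iKM) !gmulA.
have SH h : exists w, iH h = eval w by exists [:: (h, gone)]; rewrite /= (hom1 iKM) !gmul1r.
have SK k : exists w, iK k = eval w by exists [:: (gone, k)]; rewrite /= (hom1 iHM) gmul1l gmul1r.
pose jH h : sub_abs Sg := exist _ _ (SH h).
pose jK k : sub_abs Sg := exist _ _ (SK k).
have jHM : is_hom jH by move=> x y; apply: sval_inj; rewrite /= iHM.
have jKM : is_hom jK by move=> x y; apply: sval_inj; rewrite /= iKM.
have [|[f [fM [fH fK]]] _] := univ _ jH jK jHM jKM.
  by move=> a Aa; apply: sval_inj; rewrite /= iHK.
have [_ uni] := univ _ iH iK iHM iKM iHK.
have -> : g = sval (f g).
  apply: (uni id (fun g => sval (f g))) => //.
  - by move=> x y; rewrite fM.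
  - by move=> h; rewrite fH.
  - by move=> k; rewrite fK.
exact: (proj2_sig (f g)).
Qed.

(** Induction on the number of pairs: a letter lying in the amalgamated subgroup is rotated into the
    first pair and merged with its cyclic neighbours, which removes a pair. *)
Lemma amalgam_normal_form g : exists g', conj_in g g' /\
  [\/ exists h, g' = iH h, exists k, g' = iK k
    | exists w, [/\ 0 < size w, reduced w & g' = eval w]].
Proof.
case: am => iHM [iKM [iHK univ]].
have [w ->] := amalgam_generated g; move: {2}(size w).+1 (ltnSn (size w)) => n.
elim: n w => // n IH w; rewrite ltnS => sw.
have step w' : conj_in (eval w) (eval w') -> size w' < n -> exists g', conj_in (eval w) g' /\
    [\/ exists h, g' = iH h, exists k, g' = iK k
      | exists w, [/\ 0 < size w, reduced w & g' = eval w]].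
  by move=> cw /IH[g' [cg hg]]; exists g'; split=> //; exact: conj_in_trans cg.
have [w0|w0] := posnP (size w).
  exists (eval w); split; first exact: conj_in_refl.
  by apply: Or31; exists gone; rewrite (size0nil w0) (hom1 iHM).
have [rw|] := pselect (reduced w).
  by exists (eval w); split; [exact: conj_in_refl | apply: Or33; exists w].
move/existsNP => [i /not_implyP[iw /not_andP nr]].
have := eval_word_rot iH iK i w; have := size_rot i w.
rewrite /seq.rot (drop_nth (gone, gone) iw) cat_cons.
move: (nth _ w i) nr => [h k] /= nr; move: (_ ++ _) => r sr cw.
case: nr => /contrapT.
(* The letter [h] becomes [phi h] and joins [k] to the letter [k'] that precedes it cyclically, in
   the last pair. *)
- move=> Ah; case: (lastP r) sr cw => [|r' [h' k']] sr cw.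
    exists (iK (gmul (phi h) k)); split.
      by rewrite iKM -iHK //; move: cw; rewrite /= gmul1r.
    by apply: Or32; eexists.
  apply: (step (rcons r' (h', gmul k' (gmul (phi h) k)))).
    apply: conj_in_trans cw _.
    rewrite -!cats1 /= !eval_word_cat /= !gmul1r !iKM -iHK //.
    apply: conj_in_trans (conj_in_mulC _ _) _.
    by rewrite !gmulA; exact: conj_in_refl.
  by rewrite size_rcons; apply: leq_trans sw; rewrite -sr /= size_rcons.
- move=> Bk; have e : iK k = iH (psi k) by rewrite iHK ?psiK //; case: psi_iso; auto.
  case: r sr cw => [|[h' k'] r] sr cw.
    exists (iH (gmul h (psi k))); split; last by apply: Or31; eexists.
    by rewrite iHM -e; move: cw; rewrite /= gmul1r.
  apply: (step ((gmul h (gmul (psi k) h'), k') :: r)).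
    by move: cw; rewrite /= !iHM e !gmulA.
  by apply: leq_trans sw; rewrite -sr.
Qed.

End Words.

(** * The deformed representation and its trace *)

Section PartialFunctionMatrices.
Variables (T : finType) (n : nat) (v : 'I_n.+1 -> T) (w : T -> 'I_n.+1).
Hypotheses (vK : cancel v w) (wK : cancel w v).
Local Open Scope ring_scope.

(* Matrices act on row vectors, so products of matrices compose from left to right. *)
Definition pfun_mx (R : comNzRingType) (f : T -> option T) : 'M[R]_n.+1 :=
  \matrix_(i, j) (f (v i) == Some (v j))%:R.

Lemma eq_pfun_mx (R : comNzRingType) f g : f =1 g -> pfun_mx R f = pfun_mx R g.
Proof. by move=> fg; apply/matrixP => i j; rewrite !mxE fg. Qed.

Lemma pfun_mxM (R : comNzRingType) f g :
  pfun_mx R f * pfun_mx R g = pfun_mx R (fun a => obind g (f a)).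
Proof.
apply/matrixP => i j; rewrite !mxE; under eq_bigr do rewrite !mxE.
case: (f (v i)) => [a|] /=; last by rewrite big1 // => k _; rewrite mul0r.
rewrite (bigD1 (w a)) //= wK eqxx mul1r big1 ?addr0 // => k nk.
case: eqP => [[e]|]; last by rewrite mul0r.
by rewrite e vK eqxx in nk.
Qed.

Lemma pfun_mx1 (R : comNzRingType) : pfun_mx R Some = 1.
Proof.
apply/matrixP => i j; rewrite !mxE; congr (_%:R); congr nat_of_bool.
by apply/eqP/eqP => [[/(can_inj vK)]|->].
Qed.

Lemma pfun_mx0 (R : comNzRingType) f : (forall a, f a = None) -> pfun_mx R f = 0.
Proof. by move=> f0; apply/matrixP => i j; rewrite !mxE f0. Qed.

Lemma trace_pfun_mx (R : comNzRingType) f :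
  \tr (pfun_mx R f) = #|[pred a | f a == Some a]|%:R.
Proof.
rewrite /mxtrace -sum1_card natr_sum.
rewrite (reindex v) /=; last by exists w => a _; rewrite ?vK ?wK.
rewrite [RHS]big_mkcond; apply: eq_bigr => i _; rewrite !mxE inE.
by case: eqP.
Qed.

Lemma map_pfun_mx (R S : comNzRingType) (f : {rmorphism R -> S}) g :
  map_mx f (pfun_mx R g) = pfun_mx S g.
Proof. by apply/matrixP => i j; rewrite !mxE rmorph_nat. Qed.

End PartialFunctionMatrices.

Lemma finType_ord_bij (T : finType) (t0 : T) : exists (n : nat) (v : 'I_n.+1 -> T) (w : T -> 'I_n.+1),
  cancel v w /\ cancel w v.
Proof.
have e : #|T|.-1.+1 = #|T| by rewrite prednK //; apply/card_gt0P; exists t0.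
exists #|T|.-1, (fun i => enum_val (cast_ord e i)), (fun t => cast_ord (esym e) (enum_rank t)).
by split=> a; rewrite ?enum_valK ?cast_ordK ?cast_ordKV ?enum_rankK.
Qed.

(** * Leading coefficients of polynomial matrices *)

Section TopCoefficient.
Variables (R : comNzRingType) (n : nat).
Local Open Scope ring_scope.

(* [L] is the matrix of coefficients of degree [m], possibly zero. *)
Definition top_coef (m : nat) (L : 'M[R]_n.+1) (P : 'M[{poly R}]_n.+1) : Prop :=
  forall i j, (size (P i j) <= m.+1)%N /\ (P i j)`_m = L i j.

Lemma size_coef_topM (p q : {poly R}) (m m' : nat) :
  (size p <= m.+1)%N -> (size q <= m'.+1)%N ->
  (size (p * q)%R <= (m + m').+1)%N /\ (p * q)`_(m + m')%N = p`_m * q`_m'.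
Proof.
move=> sp sq; split.
  apply: leq_trans (size_polyMleq _ _) _.
  by have := leq_add sp sq; rewrite addSn addnS; case: (_ + _)%N.
rewrite coefM (bigD1 (inord m)) //= inordK ?ltnS ?leq_addr // addKn.
rewrite big1 ?addr0 // => i ni.
have [im|mi] := ltnP i m; last first.
  have {mi} mi : (m < i)%N.
    rewrite ltn_neqAle mi andbT; apply: contra ni => /eqP e.
    by apply/eqP/val_inj; rewrite /= inordK ?ltnS ?leq_addr.
  by rewrite nth_default ?mul0r //; apply: leq_trans mi.
rewrite [q`_ _]nth_default ?mulr0 //; apply: leq_trans sq _.
by rewrite ltn_subRL ltn_add2r.
Qed.

Lemma top_coefM m m' L L' P P' : top_coef m L P -> top_coef m' L' P' ->
  top_coef (m + m')%N (L * L') (P * P').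
Proof.
move=> h h' i j; rewrite !mxE; split.
  apply: (leq_trans (size_sum _ _ _)); apply/bigmax_leqP => k _.
  by have [s _] := h i k; have [s' _] := h' k j; case: (size_coef_topM s s').
rewrite coef_sum; apply: eq_bigr => k _.
have [s <-] := h i k; have [s' <-] := h' k j.
by case: (size_coef_topM s s').
Qed.

Lemma top_coef0 L : top_coef 0 L (map_mx polyC L).
Proof. by move=> i j; rewrite mxE size_polyC coefC; split=> //; exact: leq_b1. Qed.

Lemma top_coef1 c L : top_coef 1 (c *: L) (1 + (c%:P * 'X) *: map_mx polyC L).
Proof.
move=> i j; rewrite !mxE -mulrA [_ * _%:P]mulrC mulrA -polyCM; split.
  apply: leq_trans (size_polyD _ _) _; rewrite geq_max.
  have -> : (i == j)%:R = ((i == j)%:R)%:P :> {poly R} by rewrite rmorph_nat.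
  apply/andP; split; first by rewrite size_polyC; case: (_ != 0).
  apply: leq_trans (size_polyMleq _ _) _; rewrite size_polyX addn2 /=.
  by rewrite size_polyC ltnS leq_b1.
rewrite coefD coefMX /= coefC /=.
have -> : (i == j)%:R = ((i == j)%:R)%:P :> {poly R} by rewrite rmorph_nat.
by rewrite coefC /= add0r.
Qed.

Lemma top_coef_trace m L P : top_coef m L P ->
  (size (\tr P) <= m.+1)%N /\ (\tr P)`_m = \tr L.
Proof.
move=> h; split.
  apply: (leq_trans (size_sum _ _ _)); apply/bigmax_leqP => k _.
  by case: (h k k).
by rewrite /mxtrace coef_sum; apply: eq_bigr => k _; case: (h k k).
Qed.

End TopCoefficient.

(** * Powers of elements congruent to 1 modulo p *)

Section PPowers.
Variable U : nzRingType.
Local Open Scope ring_scope.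

Lemma expr1D_mod_sq (y : U) m : exists z, (1 + y) ^+ m = 1 + y *+ m + y * y * z.
Proof.
elim: m => [|m [z IH]]; first by exists 0; rewrite expr0 mulr0n mulr0 !addr0.
exists (z + m%:R + y * z); rewrite exprS IH mulrDl mul1r !mulrDr !mulrnAr !mulr1.
by rewrite mulrS !mulrA [LHS](AC (3*3) (1*(4*2)*(3*5*6))).
Qed.

(** Each further p-th power gains a factor [p]: the linear term gets it from the exponent, and the
    remaining terms contain [p ^ m.+1] twice. *)
Lemma expr_p_pow_1D (p : nat) (y : U) m : (0 < p)%N ->
  exists z, (1 + y *+ p) ^+ (p ^ m) = 1 + z *+ (p ^ m.+1).
Proof.
move=> p0; elim: m => [|m [z IH]]; first by exists y; rewrite expr1 expn1.
have [u e] := expr1D_mod_sq (z *+ p ^ m.+1) p.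
exists (z + (z * z * u) *+ (p ^ m)).
rewrite expnSr exprM IH e -addrA mulrnDl; congr (1 + (_ + _)).
  by rewrite -mulrnA -expnSr.
by rewrite mulrnAl mulrnAr !mulrnAl -!mulrnA -!expnD !addnS addSn.
Qed.

End PPowers.

Section DeformedRepresentation.
Variables (D : finGroupType) (Z : {group D}) (I : finType) (x : I -> D) (nx : I -> I).
Hypothesis xZ : forall i, x i \notin Z.
Variables (n : nat) (v : 'I_n.+1 -> D * I) (w : D * I -> 'I_n.+1).
Hypotheses (vK : cancel v w) (wK : cancel w v).

(* The inverse compensates for the left-to-right composition of [pfun_mx]. *)
Definition translate (d : D) (s : D * I) : D * I := ((d^-1 * s.1)%g, s.2).

Definition jump (s : D * I) : option (D * I) :=
  if s.1 \in Z then Some ((s.1 * x s.2)%g, nx s.2) else None.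

(** A step leads from [(z, i)] to [(d^-1 * z * x i, nx i)]. The next step is defined only over [Z],
    that is, for central [Z], if [d] agrees with [x i] modulo [Z]. *)
Definition step (d : D) (s : D * I) : option (D * I) := omap (translate d) (jump s).

Fixpoint run (ds : seq (D * D)) (s : D * I) : option (D * I) :=
  if ds is d :: ds' then obind (run ds') (obind (step d.2) (step d.1 s)) else Some s.

Local Open Scope ring_scope.
Local Notation pmx := (pfun_mx v).

Section Ring.
Variable R : comNzRingType.

Definition rho (d : D) : 'M[R]_n.+1 := pmx R (Some \o translate d).
Definition jump_mx : 'M[R]_n.+1 := pmx R jump.
Definition sigma (t : R) (d : D) : 'M[R]_n.+1 :=
  (1 + t *: jump_mx) * rho d * (1 - t *: jump_mx).

Lemma rhoM d d' : rho (d * d')%g = rho d * rho d'.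
Proof.
rewrite (pfun_mxM vK wK); apply: eq_pfun_mx => -[b i] /=.
by rewrite /translate /= invMg !mulgA.
Qed.

Lemma rho1 : rho 1%g = 1.
Proof.
rewrite -(pfun_mx1 vK); apply: eq_pfun_mx => -[b i] /=.
by rewrite /translate /= invg1 mul1g.
Qed.

(** A jump from [z] in [Z] ends at [z * x i], outside [Z], where no further jump is defined. *)
Lemma jump_mx_sq : jump_mx * jump_mx = 0.
Proof.
rewrite (pfun_mxM vK wK); apply: pfun_mx0 => -[b i].
rewrite /jump /=; case: ifP => //= bZ.
by rewrite groupMl // (negPf (xZ i)).
Qed.

Lemma jump_mx_rho d : d \in Z -> jump_mx * rho d = rho d * jump_mx.
Proof.
move=> dZ; rewrite !(pfun_mxM vK wK); apply: eq_pfun_mx => -[b i].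
by rewrite /jump /= groupMl ?groupV //; case: ifP => //= _; rewrite /translate /= mulgA.
Qed.

Lemma jump_mxK t : (1 - t *: jump_mx) * (1 + t *: jump_mx) = 1.
Proof.
by rewrite mulrDl mul1r mulNr mulrDr mulr1 -scalerAl -scalerAr jump_mx_sq !scaler0 addr0 addrK.
Qed.

Lemma jump_mxKr t : (1 + t *: jump_mx) * (1 - t *: jump_mx) = 1.
Proof. by have := jump_mxK (- t); rewrite scaleNr opprK. Qed.

Lemma sigmaM t d d' : sigma t (d * d')%g = sigma t d * sigma t d'.
Proof.
by rewrite /sigma rhoM !mulrA -[_ * _ * (1 - _) * (1 + _)]mulrA jump_mxK mulr1.
Qed.

Lemma sigma1 t : sigma t 1%g = 1.
Proof. by rewrite /sigma rho1 mulr1 jump_mxKr. Qed.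

(** This agreement on [Z] lets [sigma] on [H] and [rho] on [K] define a representation of the
    amalgamated product. *)
Lemma sigma_central t d : d \in Z -> sigma t d = rho d.
Proof.
move=> dZ; rewrite /sigma mulrDl mul1r -scalerAl jump_mx_rho // scalerAr.
by rewrite -{1}[rho d]mulr1 -mulrDr -mulrA jump_mxKr mulr1.
Qed.

Lemma sigma_mod t d (m : nat) : exists y, sigma (t *+ m) d = rho d + y *+ m.
Proof.
rewrite /sigma -!scalerMnl; set e := t *: jump_mx.
exists (e * rho d - rho d * e - (e *+ m) * rho d * e).
rewrite !mulrnDl !mulNrn mulrDl mul1r mulrDr mulr1 mulrN mulrDl opprD !mulrnAl !mulrnAr.
by rewrite !addrA.
Qed.

Definition word_mx (t : R) (ds : seq (D * D)) : 'M[R]_n.+1 :=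
  foldr (fun d m => sigma t d.1 * rho d.2 * m) 1 ds.

End Ring.

Lemma map_word_mx (R S : comNzRingType) (f : {rmorphism R -> S}) t ds :
  map_mx f (word_mx t ds) = word_mx (f t) ds.
Proof.
have fr d : map_mx f (rho R d) = rho S d by exact: map_pfun_mx.
have fe : map_mx f (jump_mx R) = jump_mx S by exact: map_pfun_mx.
elim: ds => [|d ds IH] /=; first by rewrite map_mx1.
by rewrite !rmorphM /= IH fr fr /sigma rmorphD rmorphB rmorph1 /= !map_mxZ fe.
Qed.

(** With E for [jump_mx], each pair contributes degree two, and the quadratic coefficient of its
    factor is minus the product of E [rho d.1] and E [rho d.2], the matrices of two steps. *)
Lemma word_mx_top (R : comNzRingType) ds :
  top_coef (size ds).*2 ((-1) ^+ size ds *: pmx R (run ds)) (word_mx 'X ds).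
Proof.
have mE f : map_mx polyC (pmx R f) = pmx {poly R} f by exact: map_pfun_mx.
have stepE d : pmx R (step d) = jump_mx R * rho R d.
  by rewrite (pfun_mxM vK wK); apply: eq_pfun_mx => s /=; rewrite /step; case: jump.
elim: ds => [|d ds IH] /=.
  rewrite expr0 scale1r (pfun_mx1 vK).
  by have := top_coef0 (1 : 'M[R]_n.+1); rewrite map_mx1.
rewrite doubleS -addn2 addnC exprS -scalerA.
have -> : pmx R (run (d :: ds)) = pmx R (step d.1) * pmx R (step d.2) * pmx R (run ds).
  rewrite !(pfun_mxM vK wK); apply: eq_pfun_mx => s /=.
  by case: (step d.1 s) => //= s'; case: step.
rewrite scalerAr scalerAl; apply: top_coefM => //.
rewrite !stepE /sigma.
have h1 : top_coef 1 (jump_mx R) (1 + 'X *: jump_mx {poly R}).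
  by have := top_coef1 1 (jump_mx R); rewrite [map_mx _ _]mE scale1r polyC1 mul1r.
have h2 : top_coef 1 (- jump_mx R) (1 - 'X *: jump_mx {poly R}).
  have := top_coef1 (-1) (jump_mx R).
  by rewrite [map_mx _ _]mE polyCN polyC1 mulN1r !scaleNr scale1r.
have h d' : top_coef 0 (rho R d') (rho {poly R} d').
  by have := top_coef0 (rho R d'); rewrite [map_mx _ _]mE.
have := top_coefM (top_coefM (top_coefM h1 (h d.1)) h2) (h d.2).
by rewrite !mulrN !mulNr scaleN1r !mulrA.
Qed.

End DeformedRepresentation.

(** * From distinct traces to a finite p-quotient *)

Lemma poly_nonroot_multiple (P : {poly int}) (p : nat) : 0 < p -> P != 0%R ->
  exists s : nat, P.[s%:R *+ p]%R != 0%R.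
Proof.
move=> p0 P0; apply: contrapT => /forallNP nex.
have := @max_poly_roots _ P [seq (s%:R *+ p)%R | s <- iota 0 (size P)] P0.
rewrite size_map size_iota ltnn => h; suff : false by []; apply: h.
  apply/allP => _ /mapP[s _ ->]; apply/rootP/eqP.
  by have /negP := nex s; rewrite negbK.
rewrite map_inj_uniq ?iota_uniq // => s s' /eqP.
by rewrite -!mulrnA eqr_nat eqn_pmul2r // => /eqP.
Qed.

Lemma intr_Zp_eq0 (q : nat) (m : int) : 1 < q -> `|m|%N < q ->
  (m%:~R = 0 :> 'Z_q)%R -> m = 0%R.
Proof.
move=> q1 mq m0.
have key k : k < q -> (k%:R = 0 :> 'Z_q)%R -> k = 0.
  by move=> kq /(congr1 val); rewrite /= val_Zp_nat // modn_small.
case: m mq m0 => k /= kq; first by move/key => ->.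
by rewrite NegzE mulrNz => /eqP; rewrite oppr_eq0 => /eqP /key; move/(_ kq).
Qed.

Section TraceSeparation.
Variables (p : nat) (H K : AbsGroup) (A : H -> Prop) (phi : H -> K).
Variables (G : AbsGroup) (iH : H -> G) (iK : K -> G).
Hypotheses (pp : prime p) (am : is_amalgamated_free_product A phi iH iK).
Variables (D : finGroupType) (F : H -> D) (F' : K -> D) (Z : {group D}).
Hypotheses (FM : fin_hom F) (FM' : fin_hom F') (pD : pgroup p [set: D]).
Hypotheses (FF' : forall a, A a -> F a = F' (phi a)) (FZ : forall a, A a -> F a \in Z).
Variables (I : finType) (x : I -> D) (nx : I -> I).
Hypothesis xZ : forall i, x i \notin Z.

Definition letters (w : seq (H * K)) : seq (D * D) := [seq (F hk.1, F' hk.2) | hk <- w].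
Definition fixed_points (w : seq (H * K)) : nat :=
  #|[pred s | run Z x nx (letters w) s == Some s]|.

(** The fixed points counted are, up to sign, the trace coefficient in degree twice the number of
    pairs, so the two trace polynomials differ in degree [(size wx).*2]. *)
Lemma conj_p_separated_fixed_points (wx wy : seq (H * K)) :
  size wy <= size wx -> fixed_points wx != 0 ->
  (size wy = size wx -> fixed_points wy = 0) ->
  conj_p_separated p (eval_word iH iK wx) (eval_word iH iK wy).
Proof.
move=> syx cx cy.
have [iHM [iKM [iHK univ]]] := am.
have [s0 _] : exists s, s \in [pred s | run Z x nx (letters wx) s == Some s].
  by apply/card_gt0P; rewrite lt0n.
have [n [v [w [vK wK]]]] := finType_ord_bij s0.
pose Q (u : seq (H * K)) : {poly int} :=
  (\tr (word_mx Z x nx v 'X%R (letters u)))%R.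
have QP u : size (Q u) <= (size u).*2.+1 /\
    ((Q u)`_((size u).*2) = (-1) ^+ size u * (fixed_points u)%:R)%R.
  have [] := top_coef_trace (word_mx_top Z x nx vK wK int (letters u)).
  by rewrite size_map linearZ /= (trace_pfun_mx vK wK).
pose P := (Q wx - Q wy)%R.
have P0 : P != 0%R.
  apply: contraNneq cx => /(congr1 (fun r : {poly int} => r`_((size wx).*2))%R).
  rewrite coefB coef0 (QP wx).2.
  have -> : ((Q wy)`_((size wx).*2) = 0)%R.
    move: syx; rewrite leq_eqVlt => /orP[/eqP e|lt].
      by rewrite -e (QP wy).2 cy // mulr0.
    apply: nth_default; apply: leq_trans (QP wy).1 _.
    by rewrite ltn_double.
  by move/eqP; rewrite subr0 mulf_eq0 signr_eq0 pnatr_eq0.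
have [s Ps] := poly_nonroot_multiple (prime_gt0 pp) P0.
set a := (s%:R *+ p)%R in Ps.
(* As [p ^ N] exceeds [N], the nonzero integer [P.[a]] stays nonzero modulo [q]. *)
pose N := `|P.[a]%R|%N; pose q := p ^ N.
have N0 : 0 < N by rewrite absz_gt0.
have Nq : N < q by apply: ltn_expl; exact: prime_gt1.
have q1 : 1 < q by apply: leq_trans Nq.
pose t : 'Z_q := (s%:R *+ p)%R.
(* [t] is a multiple of [p], so [sg] and [rh] agree modulo [p]; the matrix ring has
   characteristic [p ^ N]. *)
pose sg d : 'M['Z_q]_n.+1 := sigma Z x nx v t d.
pose rh d : 'M['Z_q]_n.+1 := rho v _ d.
have sgU d : sg d \is a GRing.unit.
  apply/GRing.unitrP; exists (sg d^-1%g).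
  by rewrite -!(sigmaM nx xZ vK wK) mulgV mulVg (sigma1 nx xZ vK wK).
have rhU d : rh d \is a GRing.unit.
  by apply/GRing.unitrP; exists (rh d^-1%g); rewrite -!(rhoM vK wK) mulgV mulVg (rho1 vK).
pose fH h : abs_of_fin {unit 'M['Z_q]_n.+1} := FinRing.unit _ (sgU (F h)).
pose fK k : abs_of_fin {unit 'M['Z_q]_n.+1} := FinRing.unit _ (rhU (F' k)).
have fHM : is_hom fH.
  by move=> h h'; apply: val_inj; rewrite /= (fin_homM FM); exact: (sigmaM nx xZ vK wK).
have fKM : is_hom fK.
  by move=> k k'; apply: val_inj; rewrite /= (fin_homM FM'); exact: (rhoM vK wK).
have fHK c : A c -> fH c = fK (phi c).
  move=> Ac; apply: val_inj; rewrite /= -FF' //.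
  exact: (sigma_central nx xZ vK wK _ (FZ Ac)).
have [[Th [ThM [ThH ThK]]] _] := univ _ fH fK fHM fKM fHK.
have [[pi [piM [piH piK]]] _] := univ (abs_of_fin D) F F' FM FM' FF'.
have Thw u : val (Th (eval_word iH iK u)) = word_mx Z x nx v t (letters u).
  elim: u => [|[h k] u IH] /=; first by rewrite (hom1 ThM).
  by rewrite !ThM ThH ThK -IH.
have rhM d d' : (rh (d * d')%g = rh d * rh d')%R by exact: (rhoM vK wK).
have Thp g : exists y, (val (Th g) = rh (pi g) + y *+ p)%R.
  have [u ->] := amalgam_generated am g.
  elim: u => [|[h k] u [y IH]] /=.
    by exists 0%R; rewrite (hom1 ThM) (hom1 piM) mul0rn addr0 /rh (rho1 vK).
  have [y' e'] := sigma_mod Z x nx v (s%:R : 'Z_q)%R (F h) p.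
  exists (rh (F h) * rh (F' k) * y + y' * rh (F' k) * (val (Th (eval_word iH iK u))))%R.
  rewrite !ThM !piM ThH ThK piH piK /=.
  rewrite !rhM [sg _]e'.
  rewrite mulrDl mulrDl {1}IH mulrDr -addrA mulrnDl !mulrnAl !mulrnAr.
  by rewrite -!mulrnAl.
have Thpow g : exists k, (Th g ^+ (p ^ k) = 1)%g.
  have [k1 e1] := p_elt_of_pgroup pD (pi g).
  have pe m : pi (iter m (gmul g) gone) = (pi g ^+ m)%g.
    by elim: m => [|m IH] /=; rewrite ?(hom1 piM) // piM IH expgS.
  have Te m : Th (iter m (gmul g) gone) = (Th g ^+ m)%g.
    by elim: m => [|m IH] /=; rewrite ?(hom1 ThM) // ThM IH expgS.
  (* The power [p ^ k1] kills [pi g], so [Th] takes the form [1 + y *+ p]; a further power [p ^ N]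
     makes the error a multiple of [p ^ N.+1], which is zero in ['Z_q]. *)
  have [y] := Thp (iter (p ^ k1) (gmul g) gone).
  rewrite pe Te e1 /rh (rho1 vK) => ey.
  have [z ez] := expr_p_pow_1D y N (prime_gt0 pp).
  exists (k1 + N); rewrite expnD expgM; apply: val_inj; rewrite FinRing.val_unitX ey ez.
  rewrite expnSr mulrnA -[(z *+ _)%R]scaler_nat.
  by rewrite [(_%:R)%R](_ : _ = 0%R) ?scale0r ?mul0rn ?addr0 // pchar_Zp.
apply: (conj_p_separated_of_hom pp ThM Thpow) => -[z ez].
have : (\tr (val (Th (eval_word iH iK wy))) = \tr (val (Th (eval_word iH iK wx))))%R.
  rewrite ez conjgE !FinRing.val_unitM FinRing.val_unitV -mulmxE mxtrace_mulC mulmxE.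
  by rewrite -mulrA mulrV ?mulr1 //; exact: (valP z).
rewrite !Thw.
(* Evaluation at [a] followed by reduction modulo [q] sends the indeterminate to [t]. *)
have trE u : (\tr (word_mx Z x nx v t (letters u)) = ((Q u).[a])%:~R)%R.
  have ea : (a%:~R = t)%R by rewrite /a /t rmorphMn /= rmorph_nat.
  have := map_word_mx Z x nx v (horner_eval a) 'X%R (letters u).
  rewrite /= horner_evalE hornerX => e1.
  have := map_word_mx Z x nx v (intr : {rmorphism int -> 'Z_q}) a (letters u).
  by rewrite /= ea -e1 => <-; rewrite !trace_map_mx.
rewrite !trE => /eqP; rewrite eq_sym -subr_eq0 -rmorphB -hornerN -hornerD => /eqP e0.
by move: Ps; rewrite (intr_Zp_eq0 q1 Nq e0) eqxx.
Qed.

End TraceSeparation.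

(** * Fixed points as matching rotations *)

Section CyclicSubwords.
Variables (T : Type) (x0 : T) (s : seq T).

(** Unlike in [rot], the length is free, which permits induction along a run. *)
Definition cyclic_subword (r m : nat) : seq T :=
  [seq nth x0 s (j %% size s) | j <- iota r m].

Lemma cyclic_subword_mod r m : cyclic_subword (r %% size s) m = cyclic_subword r m.
Proof.
apply: (@eq_from_nth _ x0); first by rewrite !size_map !size_iota.
move=> i; rewrite size_map size_iota => im.
by rewrite !(nth_map 0) ?size_iota // !nth_iota // modnDml.
Qed.

Lemma cyclic_subword_rot r : r < size s -> cyclic_subword r (size s) = seq.rot r s.
Proof.
move=> rs; apply: (@eq_from_nth _ x0); first by rewrite size_map size_iota size_rot.
move=> i; rewrite size_map size_iota => im.
rewrite (nth_map 0) ?size_iota // nth_iota // /seq.rot nth_cat size_drop nth_drop.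
case: ltnP => ri; first by rewrite modn_small //; move: ri; lia.
have e : r + i = (i - (size s - r)) + size s by move: rs im ri; lia.
rewrite e modnDr nth_take; last by move: rs im ri; lia.
by rewrite modn_small //; move: rs im ri; lia.
Qed.

End CyclicSubwords.

Section LongWords.
Variables (p : nat) (H K : AbsGroup) (A : H -> Prop) (B : K -> Prop).
Variables (phi : H -> K) (psi : K -> H).
Variables (G : AbsGroup) (iH : H -> G) (iK : K -> G).
Hypotheses (pp : prime p) (am : is_amalgamated_free_product A phi iH iK).
Hypotheses (Ac : is_central_subgroup A) (Bc : is_central_subgroup B).
Hypotheses (phi_iso : is_iso_on A B phi) (psi_iso : is_iso_on B A psi).
Hypothesis psiK : forall b, B b -> phi (psi b) = b.

Variables (D : finGroupType) (F : H -> D) (F' : K -> D) (Z : {group D}).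
Hypotheses (FM : fin_hom F) (FM' : fin_hom F') (pD : pgroup p [set: D]).
Hypotheses (FF' : forall a, A a -> F a = F' (phi a)).
Hypothesis ZE : forall d, d \in Z <-> exists a, A a /\ F a = d.
Hypothesis ZC : forall d e, d \in Z -> (d * e = e * d)%g.
Hypothesis FF'Z : forall h k, F h = F' k -> F h \in Z.

Variables wx wy : seq (H * K).
Local Notation n := (size wx).
Local Notation wx_ i := (nth (gone, gone) wx i).
Local Notation wy_ i := (nth (gone, gone) wy i).
Local Notation cyc := (cyclic_subword (gone, gone) wx).
Local Notation evD := (@eval_word H K (abs_of_fin D) F F').

Hypothesis wx_reduced : forall i, i < n -> F (wx_ i).1 \notin Z /\ F' (wx_ i).2 \notin Z.

Definition separates_letters (hk : H * K) : Prop := forall i, i < n ->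
  (F (gmul (ginv hk.1) (wx_ i).1) \in Z -> A (gmul (ginv hk.1) (wx_ i).1)) /\
  (F' (gmul (ginv hk.2) (wx_ i).2) \in Z -> B (gmul (ginv hk.2) (wx_ i).2)).

Definition letter (i : 'I_n * bool) : D := if i.2 then F' (wx_ i.1).2 else F (wx_ i.1).1.
Definition next_letter (i : 'I_n * bool) : 'I_n * bool :=
  if i.2 then (ordS i.1, false) else (i.1, true).

Local Notation run w := (run Z letter next_letter (letters F F' w)).

Lemma letterZ i : letter i \notin Z.
Proof. by case: i => i [] /=; case: (wx_reduced (ltn_ord i)). Qed.

Lemma cyc_cons (i : 'I_n) m : cyc i m.+1 = wx_ i :: cyc (ordS i) m.
Proof. by rewrite [in RHS]/= cyclic_subword_mod /cyclic_subword /= modn_small. Qed.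

Lemma step_letter i : step Z letter next_letter (letter i) (1%g, i) = Some (1%g, next_letter i).
Proof. by rewrite /step /jump group1 /= /translate /= mul1g mulVg. Qed.

(** Reading the letters of [wx] itself, each step cancels the letter it has just appended, so the
    group component stays 1. *)
Lemma run_cyc (i : 'I_n) m : exists j : 'I_n, j = (i + m) %% n :> nat /\
  run (cyc i m) (1%g, (i, false)) = Some (1%g, (j, false)).
Proof.
elim: m i => [|m IH] i; first by exists i; rewrite addn0 modn_small.
have [j [ej rj]] := IH (ordS i); exists j; split.
  by rewrite ej /= modnDml addSnnS.
rewrite cyc_cons -[LHS]/(obind (run (cyc (ordS i) m)) (obind
  (step Z letter next_letter (letter (i, true)))
  (step Z letter next_letter (letter (i, false)) (1%g, (i, false))))).
by rewrite step_letter /obind /oapp step_letter.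
Qed.

(** Every jump, and at the end [z'], certifies that the letter just read agrees with the current
    letter of [wx] modulo the central [Z]; the successive components telescope to the product
    formula. *)
Lemma run_matched w : (forall j, j < size w -> separates_letters (nth (gone, gone) w j)) ->
  forall z (i : 'I_n) z' s', z' \in Z -> run w (z, (i, false)) = Some (z', s') ->
  [/\ z \in Z, matched A B w (cyc i (size w)) &
    (z * evD (cyc i (size w)) = evD w * z')%g].
Proof.
elim: w => [|[h k] w IH] sep z i z' s' Zz'.
  by move=> [-> _]; split=> //=; rewrite mulg1 mul1g.
rewrite [size _]/= cyc_cons /= /step /jump /=.
case: ifP => //= Zz; rewrite /translate /=; case: ifP => //= Zz1.
move=> rw.
have [|Zz2 mat ev] := IH _ _ _ _ _ Zz' rw; first by move=> j jw; exact: (sep j.+1).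
split=> //; last by rewrite -!mulgA -ev -!mulgA !mulKVg.
have [sH sK] := sep 0 isT i (ltn_ord i).
move: sH sK Zz1 Zz2; rewrite /letter /=; case: (wx_ i) => h' k' /= sH sK Zz1 Zz2.
split=> //; [apply: sH|apply: sK].
  by move: Zz1; rewrite (ZC _ Zz) mulgA groupMr // (fin_homM FM) (fin_homV FM).
by move: Zz2; rewrite (ZC _ Zz1) mulgA groupMr // (fin_homM FM') (fin_homV FM').
Qed.

Hypothesis wy_sep : forall j, j < size wy -> separates_letters (wy_ j).
Hypothesis defect_sep : forall r, r < n -> A (defect psi wy (seq.rot r wx)) ->
  F (defect psi wy (seq.rot r wx)) = 1%g -> defect psi wy (seq.rot r wx) = gone.
Hypothesis nc : ~ conj_in (eval_word iH iK wx) (eval_word iH iK wy).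

Lemma fixed_points_reduced : 0 < n -> fixed_points F F' Z letter next_letter wx != 0.
Proof.
move=> n0; rewrite -lt0n; apply/card_gt0P; exists (1%g, (Ordinal n0, false)).
have [j [ej]] := run_cyc (Ordinal n0) n.
rewrite cyclic_subword_rot // rot0 inE => ->; rewrite add0n modnn in ej.
by apply/eqP; congr (Some (_, (_, _))); exact: val_inj.
Qed.

(** A fixed point would match [wy] with a rotation of [wx] of equal value in [D]. The defect is then
    trivial in [D], hence trivial, and the two words would be conjugate in [G]. *)
Lemma fixed_points_nonconj : 0 < n -> size wy = n -> fixed_points F F' Z letter next_letter wy = 0.
Proof.
move=> n0 sy; have y0 : 0 < size wy by rewrite sy.
apply: eq_card0 => -[z [i b]]; rewrite !inE; apply/negP => /eqP.
have Zz : run wy (z, (i, b)) = Some (z, (i, b)) -> z \in Z.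
  by case: (wy) y0 => // -[h k] w _ /=; rewrite /step /jump /=; case: (z \in Z).
move=> rz; have {}Zz := Zz rz; case: b rz => rz.
  (* A rotation by an odd number of letters would match a letter of K with one of H. *)
  case: (wy) y0 rz => // -[h k] w _ /=.
  rewrite /step /jump /= Zz /translate /=; case: ifP => //= Zz1 _.
  have := wx_reduced (ltn_ord i) => -[_ /negP]; case.
  move: Zz1; rewrite /letter /=; set k' := (wx_ i).2 => Zz1.
  have /ZE[a [Aa ea]] : (z^-1 * ((F h)^-1 * (z * F' k')))%g \in Z by rewrite groupM ?groupV.
  have e : F' k' = F (gmul h a).
    by rewrite (fin_homM FM) ea (ZC _ (groupVr Zz)) !mulgA mulgV mul1g (ZC _ Zz) mulgK.
  by rewrite e; apply: (@FF'Z _ k').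
have [_ mat ev] := run_matched wy_sep Zz rz.
rewrite sy cyclic_subword_rot // in mat ev.
have ev' : evD (seq.rot i wx) = evD wy by apply: (mulgI z); rewrite ev -ZC.
have [Ad eD] := @eval_matched H K A B phi psi Ac Bc phi_iso psi_iso psiK (abs_of_fin D)
  F F' FM FM' FF' _ _ mat.
have [_ eG] := @eval_matched H K A B phi psi Ac Bc phi_iso psi_iso psiK G
  iH iK am.1 am.2.1 am.2.2.1 _ _ mat.
have Fd : F (defect psi wy (seq.rot i wx)) = 1%g.
  apply: (@mulgI D (evD wy)); rewrite mulg1 -[RHS]ev'; exact: esym eD.
apply: nc; rewrite (defect_sep (ltn_ord i) Ad Fd) (hom1 am.1) gmul1r in eG.
by rewrite -eG; exact: eval_word_rot.
Qed.

Lemma conj_p_separated_long : 0 < n -> size wy <= n ->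
  conj_p_separated p (eval_word iH iK wx) (eval_word iH iK wy).
Proof.
move=> n0 syx.
apply: (conj_p_separated_fixed_points pp am FM FM' pD FF' _ letterZ syx).
- by move=> a Aa; apply/ZE; exists a.
- exact: fixed_points_reduced.
- exact: fixed_points_nonconj.
Qed.

End LongWords.

(** * Separation of conjugacy classes in the amalgamated product *)

Section Separation.
Variables (p : nat) (H K : AbsGroup) (A : H -> Prop) (B : K -> Prop).
Variables (phi : H -> K) (psi : K -> H).
Variables (G : AbsGroup) (iH : H -> G) (iK : K -> G).
Hypotheses (pp : prime p) (am : is_amalgamated_free_product A phi iH iK).
Hypotheses (Hcs : conj_p_separable p H).
Hypotheses (Ac : is_central_subgroup A) (Bc : is_central_subgroup B).
Hypotheses (phi_iso : is_iso_on A B phi) (psi_iso : is_iso_on B A psi).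
Hypotheses (phiK : forall a, A a -> psi (phi a) = a) (psiK : forall b, B b -> phi (psi b) = b).
Hypothesis Asep : forall C, finite_p_index_subgroup p A C -> p_separable_in p C.
Hypothesis Bsep : forall C, finite_p_index_subgroup p B C -> p_separable_in p C.

(** Prescribing this kernel on [B] makes a quotient of [K] compatible with [f] on the amalgamated
    subgroup. *)
Lemma ker_transport_finite_p_index (gT : finGroupType) (f : H -> gT) :
  fin_hom f -> pgroup p [set: gT] ->
  finite_p_index_subgroup p B (fun b => B b /\ f (psi b) = 1%g).
Proof.
move=> fM pT; apply: (ker_finite_p_index Bc (t := fun b => f (psi b))) => // a b Ba Bb.
by rewrite psi_iso.2.1 // (fin_homM fM).
Qed.

Lemma conj_p_separated_of_p_quotient (D : finGroupType) (F : H -> D) (F' : K -> D) (a b : G) :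
  fin_hom F -> fin_hom F' -> pgroup p [set: D] -> (forall a, A a -> F a = F' (phi a)) ->
  (forall f : G -> D, fin_hom f -> (forall h, f (iH h) = F h) -> (forall k, f (iK k) = F' k) ->
    ~ exists z, f b = (f a ^ z)%g) ->
  conj_p_separated p a b.
Proof.
move=> FM FM' pD FF' nc; have [_ [_ [_ univ]]] := am.
have [[f [fM [fH fK]]] _] := univ (abs_of_fin D) F F' FM FM' FF'.
apply: (conj_p_separated_of_hom pp fM); last exact: nc.
by move=> x; exact: p_elt_of_pgroup.
Qed.

Lemma conj_p_separated_left_left (h h' : H) :
  ~ conj_in (iH h) (iH h') -> conj_p_separated p (iH h) (iH h').
Proof.
move=> nc; have [|gT [f [fo [pT nf]]]] := Hcs (a := h) (b := h').
  by apply: contra_not nc; exact: (hom_conj am.1).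
have fM : fin_hom f by exact: fo.1.
have [hT [g [go phT kg _]]] := p_quotient_with_kernel pp Bc Bsep (fun i : 'I_0 => gone)
  (ker_transport_finite_p_index fM pT).
have kfg a : A a -> (f a = 1%g <-> g (phi a) = 1%g).
  move=> Aa; rewrite kg ?phiK //; last exact: phi_iso.1.
  by split=> [fa|[]//]; split=> //; exact: phi_iso.1.
have [D [F [F' [[FM FM' pD FF'] [_ cHH _ _]]]]] :=
  central_product_p_quotient pp Ac Bc phi_iso fo go pT phT kfg.
apply: (conj_p_separated_of_p_quotient FM FM' pD FF') => q qM qH qK.
by rewrite !qH => /cHH.
Qed.

(** The prescribed kernels are all of [A] and [B], while the image of [h] stays outside that of [A];
    conjugacy with an element of [K] would put it inside. *)
Lemma conj_p_separated_left_right (h : H) (k : K) : ~ A h ->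
  conj_p_separated p (iH h) (iK k).
Proof.
move=> nA.
have [gT [f [fo pT kf sf]]] := p_quotient_with_kernel pp Ac Asep (fun i : 'I_1 => h)
  (finite_p_index_self p Ac).
have [hT [g [go phT kg _]]] := p_quotient_with_kernel pp Bc Bsep (fun i : 'I_0 => gone)
  (finite_p_index_self p Bc).
have kfg a : A a -> (f a = 1%g <-> g (phi a) = 1%g).
  by move=> Aa; have Ba := phi_iso.1 _ Aa; rewrite kf // kg.
have [D [F [F' [[FM FM' pD FF'] [_ _ cHK _]]]]] :=
  central_product_p_quotient pp Ac Bc phi_iso fo go pT phT kfg.
apply: (conj_p_separated_of_p_quotient FM FM' pD FF') => q qM qH qK.
rewrite qH qK => /cHK[a [_ [Aa _ e _]]]; apply: (sf ord0) => //.
by exists a.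
Qed.

(** Only [wx] is reduced, so [wy] may be the one-pair word of an element of [H] or [K]. *)
Lemma conj_p_separated_reduced_word (wx wy : seq (H * K)) :
  0 < size wx -> reduced A B wx -> size wy <= size wx ->
  ~ conj_in (eval_word iH iK wx) (eval_word iH iK wy) ->
  conj_p_separated p (eval_word iH iK wx) (eval_word iH iK wy).
Proof.
move=> n0 red syx nc; set n := size wx; set m := size wy.
pose X i := nth (gone, gone) wx i; pose Y j := nth (gone, gone) wy j.
pose d (r : 'I_n) := defect psi wy (seq.rot r wx).
have [|N [[X0 [f0 [f0M pX0 f0N]]] sepN]] := @p_separable_family p H 'I_n (fun _ => eq gone) d.
  (* The class of the identity is a single element, so [H] is residually a finite p-group; this
     keeps the finitely many nontrivial defects out of [N]. *)
  move=> i _ y ny; have [|gT [f [fo [pT nf]]]] := Hcs (a := gone) (b := y).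
    by move=> [g e]; apply: ny; rewrite e gmul1l gmulVl.
  exists gT, f; do 2!split=> //; move=> [_ [<- e]]; apply: nf; exists 1%g.
  by rewrite conjg1.
(* To be kept outside [A]: the letters of [wx], and the quotients comparing letters of [wy] with
   letters of [wx]. *)
pose sH (i : 'I_n + 'I_m * 'I_n) := match i with
  | inl i => (X i).1 | inr (j, i) => gmul (ginv (Y j).1) (X i).1 end.
pose sK (i : 'I_n + 'I_m * 'I_n) := match i with
  | inl i => (X i).2 | inr (j, i) => gmul (ginv (Y j).2) (X i).2 end.
have f0MA a b : A a -> A b -> f0 (gmul a b) = (f0 a * f0 b)%g by move=> _ _; exact: fin_homM.
(* On [A] the new [f] has the same kernel as [f0], so it still detects the nontrivial defects lying
   in [A]. *)
have [gT [f [fo pT kf sf]]] := p_quotient_with_kernel pp Ac Asep sH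
  (ker_finite_p_index Ac pX0 f0MA).
have [hT [g [go phT kg sg]]] := p_quotient_with_kernel pp Bc Bsep sK
  (ker_transport_finite_p_index f0M pX0).
have kfg a : A a -> (f a = 1%g <-> g (phi a) = 1%g).
  move=> Aa; have Ba := phi_iso.1 _ Aa; rewrite kf // kg // phiK //.
  by split=> -[].
have [D [F [F' [[FM FM' pD FF'] [FC cHH cHK Ff]]]]] :=
  central_product_p_quotient pp Ac Bc phi_iso fo go pT phT kfg.
have [[A1 [AM AV]] _] := Ac.
have gZ : group_set [set t | `[< exists a, A a /\ F a = t >]].
  apply/group_setP; split=> [|u v].
    by rewrite inE; apply/asboolP; exists gone; rewrite (fin_hom1 FM).
  rewrite !inE => /asboolP[a [Aa <-]] /asboolP[b [Ab <-]]; apply/asboolP.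
  by exists (gmul a b); rewrite (fin_homM FM); split; auto.
pose Z := Group gZ.
have ZE t : t \in Z <-> exists a, A a /\ F a = t by rewrite inE; split=> /asboolP.
have FZ i : F (sH i) \in Z -> A (sH i).
  move/ZE => [a [Aa e]]; apply: contrapT => nA; apply: (sf i nA).
  have [|a' [_ [Aa' _ e' _]]] := cHK (sH i) (phi a); last by exists a'.
  by exists 1%g; rewrite conjg1 -FF'.
have FZ' i : F' (sK i) \in Z -> B (sK i).
  move/ZE => [a [Aa e]]; apply: contrapT => nB; apply: (sg i nB).
  have [|_ [a' [_ Aa' _ e']]] := cHK a (sK i).
    by exists 1%g; rewrite conjg1.
  by exists (phi a'); split=> //; exact: phi_iso.1.
apply: (@conj_p_separated_long p H K A B phi psi G iH iK pp am Ac Bc phi_iso psi_iso psiK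
  D F F' Z) => //.
- by move=> t e /ZE[a [Aa <-]]; exact: FC.
- move=> h k e; have [|a [_ [Aa _ e' _]]] := cHK h k.
    by exists 1%g; rewrite conjg1.
  by apply/ZE; exists a; split=> //; exact: Ff.
- move=> i ni; have [rA rB] := red i ni; split; apply/negP.
    by move/(FZ (inl (Ordinal ni))).
  by move/(FZ' (inl (Ordinal ni))).
- move=> j jm i ni; split.
    exact: (FZ (inr (Ordinal jm, Ordinal ni))).
  exact: (FZ' (inr (Ordinal jm, Ordinal ni))).
- move=> r rn Ad Fd; apply: contrapT => nd.
  have [|x e] := cHH gone (defect psi wy (seq.rot r wx)).
    by exists 1%g; rewrite conjg1 (fin_hom1 FM).
  have fM : fin_hom f by exact: fo.1.
  rewrite (fin_hom1 fM) conj1g in e; have [_ f0d] := (kf _ Ad).1 e.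
  apply: (sepN (Ordinal rn)); first by move/esym.
  by exists gone; split=> //; rewrite ginv1 gmul1l; apply/f0N.
Qed.

End Separation.

Theorem theorem2 (p : nat) (H K : AbsGroup) (A : H -> Prop) (B : K -> Prop) (phi : H -> K)
  (G : AbsGroup) (iH : H -> G) (iK : K -> G) :
  prime p ->
  conj_p_separable p H -> conj_p_separable p K ->
  is_central_subgroup A -> is_central_subgroup B ->
  is_iso_on A B phi ->
  (forall C : H -> Prop, finite_p_index_subgroup p A C -> p_separable_in p C) ->
  (forall C : K -> Prop, finite_p_index_subgroup p B C -> p_separable_in p C) ->
  is_amalgamated_free_product A phi iH iK ->
  conj_p_separable p G.
Proof.
move=> pp Hcs Kcs Ac Bc phi_iso Asep Bsep am.
have [psi [psi_iso phiK psiK]] := inverse_iso Ac.1 phi_iso.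
have am' := amalgam_sym phi_iso psi_iso phiK psiK am.
have [iHM [iKM [iHK _]]] := am.
have HH h h' : ~ conj_in (iH h) (iH h') -> conj_p_separated p (iH h) (iH h').
  exact: (conj_p_separated_left_left pp am Hcs Ac Bc phi_iso psi_iso phiK Bsep).
have KK k k' : ~ conj_in (iK k) (iK k') -> conj_p_separated p (iK k) (iK k').
  exact: (conj_p_separated_left_left pp am' Kcs Bc Ac psi_iso phi_iso psiK Asep).
have HK h k : ~ conj_in (iH h) (iK k) -> conj_p_separated p (iH h) (iK k).
  (* For [h] in [A] both elements lie in the image of [K]. *)
  have [Ah|nA _] := pselect (A h); first by rewrite iHK //; exact: KK.
  exact: (conj_p_separated_left_right pp am Ac Bc phi_iso Asep Bsep).
have long wx wy := @conj_p_separated_reduced_word p H K A B phi psi G iH iK pp am Hcs Ac Bc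
  phi_iso psi_iso phiK psiK Asep Bsep wx wy.
have eH h : iH h = eval_word iH iK [:: (h, gone)] by rewrite /= (hom1 iKM) !gmul1r.
have eK k : iK k = eval_word iH iK [:: (gone, k)] by rewrite /= (hom1 iHM) gmul1l gmul1r.
move=> x y nxy.
have [x' [cx hx]] := amalgam_normal_form psi_iso psiK am x.
have [y' [cy hy]] := amalgam_normal_form psi_iso psiK am y.
have nxy' : ~ conj_in x' y'.
  apply: contra_not nxy => c; apply: conj_in_trans cx _; apply: conj_in_trans c _.
  exact: conj_in_sym.
suff : conj_p_separated p x' y'.
  by apply: conj_p_separated_conj; apply: conj_in_sym.
have nyx' : ~ conj_in y' x' by apply: contra_not nxy'; exact: conj_in_sym.
case: hx nxy' nyx' => [[h ->]|[k ->]|[wx [x0 rx ->]]];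
  case: hy => [[h' ->]|[k' ->]|[wy [y0 ry ->]]] nxy' nyx'.
- exact: HH.
- exact: HK.
- by apply: conj_p_separated_sym; rewrite eH in nyx' *; exact: long.
- by apply: conj_p_separated_sym; exact: HK.
- exact: KK.
- by apply: conj_p_separated_sym; rewrite eK in nyx' *; exact: long.
- by rewrite eH in nxy' *; exact: long.
- by rewrite eK in nxy' *; exact: long.
- have [le|/ltnW le] := leqP (size wy) (size wx); first exact: long.
  by apply: conj_p_separated_sym; exact: long.
Qed.
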